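(* Up to isomorphism, $\mathbb{Z}_{11}^*$ is the only translatable commutative pentagonal quasigroup.
   Context: $\mathbb{Z}_{11}^*$ denotes the quasigroup on $\mathbb{Z}_{11}$ with multiplication $x\cdot y=6x+6y \pmod{11}$. A pentagonal quasigroup is a quasigroup satisfying $xx=x$, $\;(xy)(zu)=(xz)(yu)$ and $\big(((xy)x)y\big)x=y$; it is commutative if $xy=yx$ for all $x,y$. A finite quasigroup of order $n$ is translatable if for some integer $k$ with $1\le k<n$ and some ordering $x^{(1)},\ldots,x^{(n)}$ of its elements it is $k$-translatable, i.e. for each $q\in\{2,\ldots,n\}$ the $q$-th row of its multiplication table (with rows and columns in this ordering) is obtained from the $(q-1)$-st row by moving the last $k$ entries to the front (keeping their order) followed by the first $n-k$ entries; equivalently $x^{(i)}\cdot x^{(j)}=x^{(i+1)}\cdot x^{(j+k)}$ for all $i,j$, with indices modulo $n$. By definition infinite quasigroups are not translatable. *)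

(* Defs.v *)
From mathcomp Require Import all_boot all_algebra.
Set Implicit Arguments.
Unset Strict Implicit.
Unset Printing Implicit Defensive.
Local Open Scope ring_scope.

Definition quasigroup (Q : Type) (op : Q -> Q -> Q) : Prop :=
  (forall a b : Q, exists! x, op a x = b) /\
  (forall a b : Q, exists! y, op y a = b).

Definition pentagonal (Q : Type) (op : Q -> Q -> Q) : Prop :=
  [/\ quasigroup op,
      forall x, op x x = x,
      forall x y z u, op (op x y) (op z u) = op (op x z) (op y u)
    & forall x y, op (op (op (op x y) x) y) x = y].

(* Row q of the multiplication table, rows and columns being ordered by x. *)
Definition table_row (Q : Type) (op : Q -> Q -> Q) (n : nat) (x : 'I_n -> Q)
    (q : 'I_n) : seq Q :=
  [seq op (x q) (x j) | j <- enum 'I_n].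

(* [rotr k] moves the last k entries of a sequence to its front. *)
Definition k_translatable (Q : Type) (op : Q -> Q -> Q) (n k : nat)
    (x : 'I_n -> Q) : Prop :=
  forall p q : 'I_n, q = p.+1 :> nat ->
    table_row op x q = rotr k (table_row op x p).

(* The bijection x : 'I_n -> Q is an ordering of Q; its existence makes Q
   finite of order n, so infinite quasigroups are not translatable. *)
Definition translatable (Q : Type) (op : Q -> Q -> Q) : Prop :=
  exists (n k : nat) (x : 'I_n -> Q),
    [/\ bijective x, (1 <= k < n)%N & k_translatable op k x].

Definition isomorphic (Q1 Q2 : Type) (op1 : Q1 -> Q1 -> Q1)
    (op2 : Q2 -> Q2 -> Q2) : Prop :=
  exists2 f : Q1 -> Q2, bijective f & {morph f : x y / op1 x y >-> op2 x y}.

Definition translatable_comm_pentagonal (Q : Type) (op : Q -> Q -> Q) : Prop :=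
  [/\ pentagonal op, commutative op & translatable op].

Definition Z11star (x y : 'Z_11) : 'Z_11 := 6%:R * x + 6%:R * y.

(* Main.v *)
Require Import Defs.
From mathcomp Require Import all_boot all_algebra.
From mathcomp Require Import ring.

(** The order [n] is at least 2, so the indices of the ordering [x] can be read
in the ring Z/n.  There, translatability says [x_i x_j = x_0 x_(j - k i)].
Commutativity gives [x_0 x_1 = x_1 x_0 = x_0 x_(-k)], hence [-k = 1] by
cancellation, and the table is that of addition up to relabelling:
[x_i x_j = x_0 x_(i + j)].  Idempotency gives [x_i = x_0 x_(i + i)], so 2 has an
inverse [h] (the index of [x_0 x_1]) and [x_i x_j = x_(h (i + j))]: the
quasigroup is the midpoint operation of Z/n ([translatable_midpoint]).

The pentagonal law at [x_0], [x_1] then reads [h^4 + h^2 = 1]; multiplying by 16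
gives [1 + 4 = 16], that is [11 = 0] in Z/n.  As 11 is prime, [n = 11], and
[h = 6].  Conversely, in any commutative ring where [11 = 0] the midpoint
operation is pentagonal ([midpoint_pentagonal]), and over Z/n it is translatable
for [k = n - 1], because it depends only on the sum of the arguments. *)

Set Implicit Arguments.
Unset Strict Implicit.
Unset Printing Implicit Defensive.
Import GRing.Theory.
Local Open Scope ring_scope.

(** Moving the last [k] entries to the front sends the entry of index [j] to
index [j + k] modulo the length, so equality of two rows up to [rotr k] becomes
an identity between entries, with indices added in the ring Z/n. *)
Lemma k_translatableP (Q : Type) (op : Q -> Q -> Q) (m k : nat)
    (x : 'I_m.+2 -> Q) : (k <= m.+2)%N ->
  k_translatable op k x <->
  (forall p q : 'I_m.+2, q = p.+1 :> nat ->
     forall j, op (x p) (x j) = op (x q) (x (j + k%:R))).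
Proof.
move=> le_kn.
have sz r : size (table_row op x r) = m.+2 by rewrite size_map size_enum_ord.
have nth_row r (j : 'I_m.+2) y : nth y (table_row op x r) j = op (x r) (x j).
  by rewrite (nth_map j) ?size_enum_ord // nth_ord_enum.
have val_shift (j : 'I_m.+2) : j + k%:R = ((j + k) %% m.+2)%N :> nat.
  by rewrite Zp_nat /= modnDmr.
have nth_rotr r (j : 'I_m.+2) y :
    nth y (rotr k (table_row op x r)) (j + k%:R)%R = op (x r) (x j).
  rewrite val_shift /rotr /rot sz nth_cat size_drop sz subKn // nth_drop.
  have lt_jn := ltn_ord j.
  have [lt_jk|le_kj] := ltnP (j + k) m.+2.
    rewrite modn_small // ltnNge leq_addl /= addnK.
    by rewrite nth_take ?nth_row // ltn_subRL addnC.
  have -> : ((j + k) %% m.+2 = j + k - m.+2)%N.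
    rewrite -{1}(subnK le_kj) modnDr modn_small // ltn_subLR //.
    by rewrite -addSn leq_add.
  rewrite ltn_subLR // ltn_add2r lt_jn -(nth_row r j y); congr nth.
  by rewrite addnC addnBA // subnK // addnK.
split=> [trx p q pq j|trx p q pq].
  have y := x j.
  by rewrite -(nth_row q _ y) (trx p q pq) nth_rotr.
apply: (@eq_from_nth _ (x p)) => [|i]; rewrite ?size_rotr ?sz // => lt_in.
have -> : i = (Ordinal lt_in - k%:R + k%:R : 'I_m.+2) :> nat by rewrite subrK.
by rewrite nth_rotr nth_row (trx p q pq).
Qed.

Section Midpoint.

Variables (A : comNzRingType) (h : A).
Hypothesis half : h * 2%:R = 1.

Let mid (x y : A) := h * x + h * y.

Lemma midpoint_quasigroup : quasigroup mid.
Proof.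
have solve a b : mid a (2%:R * b - a) = b.
  by rewrite /mid -mulrDr addrC subrK mulrA half mul1r.
have uniq a b c : mid a c = b -> 2%:R * b - a = c.
  by move=> <-; rewrite /mid -mulrDr mulrA (mulrC _ h) half mul1r addrC addKr.
have midC a b : mid a b = mid b a by exact: addrC.
by split=> a b; exists (2%:R * b - a); split=> [|c]; rewrite ?(midC _ a);
  try exact: solve; exact: uniq.
Qed.

(** The pentagonal word evaluates to [(h^4 + h^3 + h) x + (h^4 + h^2) y].  Both
coefficient identities hold after multiplication by the unit 16, where they
become [1 + 2 + 8 = 11 = 0] and [1 + 4 = 16 - 11]. *)
Lemma midpoint_pentagonal : 11%:R = 0 :> A -> pentagonal mid.
Proof.
move=> eleven; split.
- exact: midpoint_quasigroup.
- by move=> x; rewrite /mid -mulrDr -mulr2n -mulr_natl mulrA half mul1r.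
- by move=> x y z u; rewrite /mid; ring.
move=> x y; apply/eqP; rewrite -subr_eq0; apply/eqP.
have h4 : h ^+ 4 * 16%:R = 1.
  by transitivity ((h * 2%:R) ^+ 4); [ring | rewrite half expr1n].
(* 16 times the difference of both sides, with each power of [2 h] kept visible
   so that it can be replaced by 1. *)
pose a := 2%:R * h.
have a1 : a = 1 by rewrite /a mulrC.
rewrite -[LHS]mul1r -h4 -mulrA.
transitivity (h ^+ 4 * ((a ^+ 4 + 2%:R * a ^+ 3 + 8%:R * a) * x
                        + (a ^+ 4 + 4%:R * a ^+ 2 - 16%:R) * y)).
  by rewrite /mid /a; ring.
rewrite a1; transitivity (h ^+ 4 * (11%:R * (x - y))); first by ring.
by rewrite eleven mul0r mulr0.
Qed.

End Midpoint.

(** The shift is [k = n - 1], which is [-1] in Z/n: the operation depends only on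
the sum of its arguments, and [(i + 1) + (j - 1) = i + j]. *)
Lemma midpoint_translatable (m : nat) (h : 'I_m.+2) :
  translatable (fun x y : 'I_m.+2 => h * x + h * y).
Proof.
exists m.+2, m.+1, id; split; [by exists id | by rewrite /= ltnSn |].
apply/k_translatableP => // p q pq j.
have -> : q = p + 1.
  by apply: val_inj; rewrite /= pq modnDmr addn1 modn_small // -pq.
have mE : m.+1%:R = -1 :> 'I_m.+2.
  by apply/eqP; rewrite -addr_eq0 natr1; apply/eqP; exact: (@pchar_Zp m.+2).
by rewrite mE; ring.
Qed.

(** Row [i] is row 0 after [i] one-step shifts. *)
Lemma translatable_row0 (Q : Type) (op : Q -> Q -> Q) (m k : nat)
    (x : 'I_m.+2 -> Q) : (k <= m.+2)%N -> k_translatable op k x ->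
  forall i j, op (x i) (x j) = op (x 0) (x (j - k%:R * i)).
Proof.
move=> le_kn /(k_translatableP _ _ le_kn) trx [i lt_in].
elim: i lt_in => [|i IHi] lt_in j.
  have -> : Ordinal lt_in = 0 by exact: val_inj.
  by rewrite mulr0 subr0.
have lt_in' := ltnW lt_in.
rewrite -{1}(subrK k%:R j) -(trx (Ordinal lt_in')) // IHi.
have -> : Ordinal lt_in = Ordinal lt_in' + 1.
  by apply: val_inj; rewrite /= modnDmr addn1 modn_small.
by congr (op _ (x _)); ring.
Qed.

(** Row 0 has distinct entries, so an equality between two of them is an equality
of indices.  Commutativity at [(0, 1)] fixes the shift, [-k = 1], and idempotency
fixes row 0: the element [x_i] stands there at position [2 i]. *)
Lemma translatable_midpoint (Q : Type) (op : Q -> Q -> Q) (m k : nat)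
    (x : 'I_m.+2 -> Q) :
    quasigroup op -> (forall a, op a a = a) -> commutative op ->
    bijective x -> (k <= m.+2)%N -> k_translatable op k x ->
  exists2 h : 'I_m.+2, h * 2%:R = 1
    & forall i j, op (x i) (x j) = x (h * i + h * j).
Proof.
move=> [qg _] idem opC [y xK yK] le_kn trx.
have row0 := translatable_row0 le_kn trx.
have inj0 i j : op (x 0) (x i) = op (x 0) (x j) -> i = j.
  move=> eq_ij; apply: (can_inj xK).
  by have [z [_ uz]] := qg (x 0) (op (x 0) (x j)); rewrite -(uz _ eq_ij) (uz (x j)).
have kE : - k%:R = 1 :> 'I_m.+2.
  by apply: inj0; rewrite [RHS]opC (row0 1) mulr1 sub0r.
have add0 i j : op (x i) (x j) = op (x 0) (x (i + j)).
  by rewrite row0 -mulNr kE mul1r addrC.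
pose h := y (op (x 0) (x 1)).
have half : h * 2%:R = 1.
  by apply: inj0; rewrite mulr_natr mulr2n -add0 idem /h yK.
exists h => // i j; rewrite add0 -[RHS]idem [RHS]add0; congr (op _ (x _)).
by rewrite -mulrDr -mulr2n -mulr_natr mulrAC half mul1r.
Qed.

(** With first argument [x_0] and second [x_1], the pentagonal word is [x_w] for
[w = h (h (h h) + h)]; so [w = 1], while [16 w = 5] because [2 h = 1]. *)
Lemma midpoint_order_11 (Q : Type) (op : Q -> Q -> Q) (m : nat)
    (x : 'I_m.+2 -> Q) (h : 'I_m.+2) :
    (forall a b, op (op (op (op a b) a) b) a = b) -> injective x ->
    h * 2%:R = 1 -> (forall i j, op (x i) (x j) = x (h * i + h * j)) ->
  m.+2 = 11%N.
Proof.
move=> pent xI half opx.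
have := pent (x 0) (x 1); rewrite !opx => /xI.
rewrite !(mulr0, add0r, addr0, mulr1) => pent1.
have eleven : 11%:R = 0 :> 'I_m.+2.
  pose a := h * 2%:R.
  transitivity (16%:R * (1 - h * (h * (h * h) + h))
                + (a ^+ 4 + 4%:R * a ^+ 2 - 5%:R)); first by rewrite /a; ring.
  by rewrite pent1 /a half !expr1n; ring.
have n11 : (m.+2 %| 11)%N.
  by have /(congr1 val) := eleven; rewrite Zp_nat => /eqP.
have /primeP[_ /(_ _ n11) /orP[//|/eqP]] : prime 11 by [].
by [].
Qed.

Theorem theorem4p4 :
  translatable_comm_pentagonal Z11star /\
  (forall (Q : Type) (op : Q -> Q -> Q),
     translatable_comm_pentagonal op -> isomorphic op Z11star).
Proof.
have half6 : 6%:R * 2%:R = 1 :> 'Z_11 by apply/eqP.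
split.
  split; last exact: midpoint_translatable.
    by apply: midpoint_pentagonal => //; apply/eqP.
  by move=> x y; exact: addrC.
move=> Q op [[qg idem _ pent] opC [n [k [x [bij_x /andP[k_gt0 lt_kn] trx]]]]].
case: n => [|[|m]] in x bij_x lt_kn trx; first by rewrite ltn0 in lt_kn.
  by rewrite ltnS leqNgt k_gt0 in lt_kn.
have [h half opx] := translatable_midpoint qg idem opC bij_x (ltnW lt_kn) trx.
have [m9] := midpoint_order_11 pent (bij_inj bij_x) half opx.
subst m; have [y xK yK] := bij_x.
(* The inverse of 2 is unique, and 6 is one modulo 11. *)
have h6 : h = 6%:R :> 'Z_11.
  by rewrite -[LHS]mulr1 -[X in h * X]half6 mulrCA half mulr1.
exists y; first by exists x.
by move=> a b; rewrite -{1}(yK a) -{1}(yK b) opx xK h6.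
Qed.
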